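(* Let $(M,g)$ be an $n$-dimensional semi-Riemannian spin manifold. If $V$ is an exact vector field on $M$, i.e. $V=\mathrm{grad}\, f$ for some function $f$ on $M$, then the $V$-Dirac spectrum, i.e. the spectrum of the Dirac operator $D$ of the metric connection with vectorial torsion $V$, is the same as the spectrum of the Riemannian Dirac operator $D^g$.
   Context: $\nabla^g$ is the Levi-Civita connection. The metric connection with vectorial torsion $V$ is $\nabla_XY=\nabla^g_XY+g(X,Y)V-g(V,Y)X$. It lifts to the spinor bundle $\Sigma M$ as $\nabla_X\psi=\nabla^g_X\psi+\frac12(X\wedge V)\cdot\psi$, where the dot is Clifford multiplication, with $X\cdot\omega=X\wedge\omega-X\lrcorner\,\omega$ for a vector $X$ (identified with a 1-form via $g$) and a form $\omega$. $D^g$ is the Dirac operator associated with $\nabla^g$, and $D$ is the Dirac operator associated with $\nabla$; it satisfies $D\psi=D^g\psi-\frac{n-1}{2}V\cdot\psi$. *)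

(* Defs.v *)
From HB Require Import structures.
From mathcomp Require Import all_boot all_order all_algebra.
From mathcomp Require Import all_classical all_reals all_analysis.
From mathcomp Require Import complex ring.

Set Implicit Arguments.
Unset Strict Implicit.
Unset Printing Implicit Defensive.

Import Order.TTheory GRing.Theory Num.Theory.
Import numFieldNormedType.Exports.

Local Open Scope classical_set_scope.
Local Open Scope ring_scope.
Local Open Scope complex_scope.

(* [O] is meant to be open in a finite-dimensional space: there, continuity
   of all iterated directional derivatives is the usual notion of C^k. *)
Fixpoint class_C {R : realType} {E F : normedModType R} (k : nat)
    (O : set E) (f : E -> F) : Prop :=
  (forall x, O x -> {for x, continuous f}) /\
  match k with
  | 0 => True
  | k'.+1 => forall v : E,
      (forall x, O x -> derivable f x v) /\ class_C k' O (fun x => 'D_v f x)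
  end.

Definition class_Coo {R : realType} {E F : normedModType R}
  (O : set E) (f : E -> F) : Prop := forall k, class_C k O f.

(* A chart is given by a map [coord i] together with an inverse [param i]; both
   are total functions, meaningful on [dom i] and on its image respectively.
   [chart_at x] is a preferred chart around [x]; it is only used to evaluate at
   [x] expressions which do not depend on the chart. *)
Record smooth_manifold (R : realType) (n : nat) (M : topologicalType) :=
  SmoothManifold {
  chart : Type;
  dom : chart -> set M;
  coord : chart -> M -> 'rV[R]_n;
  param : chart -> 'rV[R]_n -> M;
  chart_at : M -> chart;
  manifold_hausdorff : hausdorff_space M;
  manifold_second_countable : @second_countable M;
  dom_open : forall i, open (dom i);
  image_open : forall i, open (coord i @` dom i);
  coordK : forall i x, dom i x -> param i (coord i x) = x;
  coord_continuous : forall i x, dom i x -> {for x, continuous (coord i)};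
  param_continuous : forall i x, dom i x ->
    {for coord i x, continuous (param i)};
  chart_atP : forall x, dom (chart_at x) x;
  transition_smooth : forall i j,
    class_Coo (coord i @` (dom i `&` dom j)) (coord j \o param i)
}.

Section Manifold.
Context {R : realType} {n : nat} {M : topologicalType}.
Variable A : smooth_manifold R n M.

(* Local data are families indexed by the charts: for a vector field [X],
   [X i x] is the row vector of the components of X(x) in the chart [i], and
   is meaningful only when [dom i x]. *)
Definition local_field := chart A -> M -> 'rV[R]_n.

Definition smooth_in (F : normedModType R) (i : chart A) (W : set M)
  (h : M -> F) : Prop := class_Coo (coord i @` (dom i `&` W)) (h \o param i).

Definition smooth (F : normedModType R) (W : set M) (h : M -> F) : Prop :=
  forall i, smooth_in i W h.

(* du(h) at x, for a tangent vector with components [u] in the chart [i]. *)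
Definition ddir (F : normedModType R) (i : chart A) (h : M -> F) (x : M)
  (u : 'rV[R]_n) : F := 'D_u (h \o param i) (coord i x).

Definition pushfwd (i j : chart A) (x : M) (u : 'rV[R]_n) : 'rV[R]_n :=
  ddir i (coord j) x u.

Definition vector_field_on (W : set M) (X : local_field) : Prop :=
  (forall i, smooth_in i W (X i)) /\
  (forall i j x, W x -> dom i x -> dom j x -> X j x = pushfwd i j x (X i x)).

Definition vector_field (X : local_field) : Prop := vector_field_on setT X.

End Manifold.

(* Signs of a pseudo-orthonormal basis in signature (p, n - p). *)
Definition eps {R : realType} {n : nat} (p : nat) (a : 'I_n) : R :=
  if (a < p)%N then 1 else -1.

Definition bil {R : realType} {n : nat} (G : 'M[R]_n) (u v : 'rV[R]_n) : R :=
  (u *m G *m v^T) 0 0.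

Record semi_riemannian_metric (R : realType) (n p : nat) (M : topologicalType)
    (A : smooth_manifold R n M) := Metric {
  gram : chart A -> M -> 'M[R]_n;
  gram_smooth : forall i, smooth_in i setT (gram i);
  gram_transition : forall i j x, dom i x -> dom j x -> forall u v,
    bil (gram j x) (pushfwd i j x u) (pushfwd i j x v) = bil (gram i x) u v;
  gram_sym : forall i x, dom i x -> (gram i x)^T = gram i x;
  gram_signature : forall i x, dom i x ->
    exists2 P : 'M[R]_n, P \in unitmx &
      P *m gram i x *m P^T = diag_mx (\row_a eps p a)
}.

Section Connections.
Context {R : realType} {n p : nat} {M : topologicalType}.
Context {A : smooth_manifold R n M}.
Variable g : semi_riemannian_metric p A.

Definition gip (i : chart A) (x : M) (u v : 'rV[R]_n) : R :=
  bil (gram g i x) u v.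

(* [nabla i Y x u] : components in the chart [i] of the covariant derivative at
   [x], in the direction [u], of the field with components [Y]. *)
Definition connection := chart A -> (M -> 'rV[R]_n) -> M -> 'rV[R]_n ->
  'rV[R]_n.

(* First kind: the metric is constant equal to [u], [v] and [w] in the chart. *)
Definition christoffel1 (i : chart A) (x : M) (u v w : 'rV[R]_n) : R :=
  2^-1 * (bil (ddir i (gram g i) x u) v w + bil (ddir i (gram g i) x v) u w
          - bil (ddir i (gram g i) x w) u v).

Definition christoffel (i : chart A) (x : M) (u v : 'rV[R]_n) : 'rV[R]_n :=
  (\row_k christoffel1 i x u v (delta_mx 0 k)) *m invmx (gram g i x).

Definition levi_civita : connection := fun i Y x u =>
  ddir i Y x u + christoffel i x u (Y x).

Definition vectorial_torsion (V : local_field A) : connection := fun i Y x u =>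
  levi_civita i Y x u + gip i x u (Y x) *: V i x - gip i x (V i x) (Y x) *: u.

Definition is_gradient (V : local_field A) (f : M -> R) : Prop :=
  forall i x, dom i x -> forall u, gip i x (V i x) u = ddir i f x u.

Definition exact_field (V : local_field A) : Prop :=
  vector_field V /\ exists2 f : M -> R, smooth A setT f & is_gradient V f.

End Connections.

(* A complex module of dimension 2^(n/2) over the Clifford algebra of R^{p,n-p};
   the sign matches X . omega = X /\ omega - X _| omega, i.e. X . X = - g(X,X).
   By dimension, it is irreducible. *)
Record spinor_module (R : realType) (n p : nat) := SpinorModule {
  gam : 'I_n -> 'M[R[i]]_(2 ^ n./2);
  gamP : forall a b, gam a *m gam b + gam b *m gam a =
    (- (2 * eps p a * (a == b)%:R)%:C)%:M
}.

Section SpinGroup.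
Context {R : realType} {n p : nat} (G : spinor_module R n p).

Definition clif (v : 'rV[R]_n) : 'M[R[i]]_(2 ^ n./2) :=
  \sum_a (v 0 a)%:C *: gam G a.

(* The spin representation of Spin(p, n - p) is faithful, also for [n] odd, so
   the group is identified with its image: the products of an even number of
   unit vectors. *)
Definition in_spin (s : 'M[R[i]]_(2 ^ n./2)) : Prop :=
  exists vs : seq 'rV[R]_n,
  [/\ ~~ odd (size vs),
      forall v, v \in vs -> `| \sum_a eps p a * v 0 a ^+ 2 | = 1 &
      s = \big[mulmx/1%:M]_(v <- vs) clif v].

(* [s] lies over [L] in the covering Spin(p, n - p) -> SO(p, n - p); the
   columns of [L] are the images of the basis vectors. *)
Definition spin_covers (s : 'M[R[i]]_(2 ^ n./2)) (L : 'M[R]_n) : Prop :=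
  forall b, s *m gam G b *m invmx s = \sum_a (L a b)%:C *: gam G a.

End SpinGroup.

Definition smooth_cmx {R : realType} {n : nat} {M : topologicalType}
    (A : smooth_manifold R n M) (r c : nat) (W : set M)
    (h : M -> 'M[R[i]]_(r, c)) : Prop :=
  forall k l, smooth A W (fun x => complex.Re (h x k l)) /\
              smooth A W (fun x => complex.Im (h x k l)).

(* A spin structure given by its transition functions: local pseudo-orthonormal
   frames over an open cover, and lifts to Spin(p, n - p) of the changes of
   frame, e^k = e^j . lambda(s_jk), forming a cocycle (the orientation is the
   one defined by the frames). *)
Record spin_structure (R : realType) (n p : nat) (M : topologicalType)
    (A : smooth_manifold R n M) (g : semi_riemannian_metric p A)
    (G : spinor_module R n p) :=
  SpinStructure {
  sidx : Type;
  sdom : sidx -> set M;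
  frame : sidx -> 'I_n -> local_field A;
  spin_lift : sidx -> sidx -> M -> 'M[R[i]]_(2 ^ n./2);
  sdom_open : forall j, open (sdom j);
  sdom_cover : forall x, exists j, sdom j x;
  frame_field : forall j a, vector_field_on (sdom j) (frame j a);
  frame_orthonormal : forall j i x, sdom j x -> dom i x -> forall a b,
    gip g i x (frame j a i x) (frame j b i x) = eps p a * (a == b)%:R;
  lift_smooth : forall j k, smooth_cmx A (sdom j `&` sdom k) (spin_lift j k);
  lift_spin : forall j k x, sdom j x -> sdom k x -> in_spin G (spin_lift j k x);
  lift_covers : forall j k x, sdom j x -> sdom k x ->
    exists2 L : 'M[R]_n, spin_covers G (spin_lift j k x) L &
      forall i, dom i x -> forall b,
        frame k b i x = \sum_a L a b *: frame j a i x;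
  lift_cocycle : forall j k l x, sdom j x -> sdom k x -> sdom l x ->
    spin_lift j k x *m spin_lift k l x = spin_lift j l x
}.

Section Spinors.
Context {R : realType} {n p : nat} {M : topologicalType}.
Context {A : smooth_manifold R n M} {g : semi_riemannian_metric p A}.
Context {G : spinor_module R n p}.
Variable S : spin_structure g G.

(* A section of the spinor bundle is a family [psi] of local spinors, [psi j]
   being its expression with respect to the [j]-th frame, meaningful on
   [sdom j]. *)
Definition local_spinor := sidx S -> M -> 'cV[R[i]]_(2 ^ n./2).

Definition spinor_field (psi : local_spinor) : Prop :=
  (forall j, smooth_cmx A (sdom j) (psi j)) /\
  (forall j k x, sdom j x -> sdom k x -> psi j x = spin_lift j k x *m psi k x).

Definition spinor_eq (psi phi : local_spinor) : Prop :=
  forall j x, sdom j x -> psi j x = phi j x.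

(* Clifford multiplication by the tangent vector of components [u] in the chart
   [i], with respect to the [j]-th frame. *)
Definition clifford (j : sidx S) (i : chart A) (x : M) (u : 'rV[R]_n) :
    'M[R[i]]_(2 ^ n./2) :=
  clif G (\row_a (eps p a * gip g i x u (frame j a i x))).

(* X /\ Y acts by X . Y + g(X, Y), since X . Y = X /\ Y - X _| Y. *)
Definition wedge_clifford (j : sidx S) (i : chart A) (x : M)
    (u v : 'rV[R]_n) : 'M[R[i]]_(2 ^ n./2) :=
  clifford j i x u *m clifford j i x v + ((gip g i x u v)%:C)%:M.

Definition dspinor (psi : local_spinor) (j : sidx S) (i : chart A) (x : M)
    (u : 'rV[R]_n) : 'cV[R[i]]_(2 ^ n./2) :=
  \col_k (ddir i (fun y => complex.Re (psi j y k 0) : R) x u +i*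
          ddir i (fun y => complex.Im (psi j y k 0) : R) x u).

(* The lift to spinors of a metric connection. *)
Definition spin_connection (nabla : connection) (psi : local_spinor)
    (j : sidx S) (i : chart A) (x : M) (u : 'rV[R]_n) :
    'cV[R[i]]_(2 ^ n./2) :=
  dspinor psi j i x u +
  (\sum_a \sum_b (4^-1 * eps p a * eps p b *
      gip g i x (nabla i (frame j a i) x u) (frame j b i x))%:C *:
    (gam G a *m gam G b)) *m psi j x.

Definition dirac_operator (nabla : connection) (psi : local_spinor) :
    local_spinor := fun j x => let i := chart_at A x in
    \sum_a (eps p a)%:C *:
      (gam G a *m spin_connection nabla psi j i x (frame j a i x)).

Definition eigenvalues (D : local_spinor -> local_spinor) : set R[i] :=
  [set lam | exists psi, [/\ spinor_field psi,
     ~ spinor_eq psi (fun _ _ => 0) &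
     spinor_eq (D psi) (fun j x => lam *: psi j x)]].

(* [lam] is in the spectrum when D - lam is not a bijection of the space of
   smooth spinor fields onto itself. *)
Definition spectrum (D : local_spinor -> local_spinor) : set R[i] :=
  [set lam | ~ forall phi, spinor_field phi ->
     (exists psi, [/\ spinor_field psi,
        spinor_eq (fun j x => D psi j x - lam *: psi j x) phi &
        forall psi', spinor_field psi' ->
          spinor_eq (fun j x => D psi' j x - lam *: psi' j x) phi ->
          spinor_eq psi' psi])].

End Spinors.

Arguments dirac_operator {R n p M A g G} S nabla psi.

Section Bil.
Context {R : realType} {n : nat}.
Implicit Types (B : 'M[R]_n) (u v : 'rV[R]_n).
Lemma bilDl B u1 u2 v : bil B (u1 + u2) v = bil B u1 v + bil B u2 v.
Proof. by rewrite /bil !mulmxDl mxE. Qed.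
Lemma bilZl B c u v : bil B (c *: u) v = c * bil B u v.
Proof. by rewrite /bil -!scalemxAl mxE. Qed.
Lemma bilBl B u1 u2 v : bil B (u1 - u2) v = bil B u1 v - bil B u2 v.
Proof. by rewrite -scaleN1r bilDl bilZl mulN1r. Qed.
Lemma bilC B u v : B^T = B -> bil B u v = bil B v u.
Proof.
move=> hB; rewrite /bil -[u *m B *m v^T]trmxK [LHS]mxE.
by rewrite trmx_mul trmxK trmx_mul hB mulmxA.
Qed.
Lemma epsK p (a : 'I_n) : eps p a * eps p a = 1 :> R.
Proof. by rewrite /eps; case: ifP; rewrite ?mulrNN mulr1. Qed.
End Bil.

(* The lift of the metric connection with vectorial torsion V is
   nabla^g_X + (1/2) (X /\ V), and its Dirac operator is D^g - (n-1)/2 V. *)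
Section VectorialDirac.
Context {R : realType} {n p : nat} {M : topologicalType}.
Context {A : smooth_manifold R n M} {g : semi_riemannian_metric p A}.
Context {G : spinor_module R n p} {S : spin_structure g G}.
Local Notation rc := (real_complex R).

Lemma frame_parseval (j : sidx S) i x u v : sdom j x -> dom i x ->
  \sum_a eps p a * gip g i x u (frame j a i x) * gip g i x v (frame j a i x)
  = gip g i x u v.
Proof.
move=> jx ix.
pose F := \matrix_a frame j a i x; pose Gr := gram g i x.
pose eta : 'M[R]_n := diag_mx (\row_a eps p a).
have bilF k l :
    (F *m Gr *m F^T) k l = gip g i x (frame j k i x) (frame j l i x).
  rewrite /gip /bil !mxE; apply: eq_bigr => m _; rewrite !mxE; congr (_ * _).
  by apply: eq_bigr => q _; rewrite !mxE.
have FE : F *m Gr *m F^T = eta.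
  apply/matrixP => a b; rewrite bilF (frame_orthonormal jx ix).
  by rewrite !mxE mulr_natr.
have eta2 : eta *m eta = 1%:M.
  apply/matrixP=> a b; rewrite mul_diag_mx !mxE mulrnAr.
  by case: eqVneq => [->|_]; rewrite ?epsK ?mulr0n// -eq_sym.
have H1 : F *m (Gr *m F^T *m eta) = 1%:M by rewrite !mulmxA FE eta2.
have H2 := mulmx1C H1.
transitivity ((u *m (Gr *m F^T *m eta *m F) *m (Gr *m v^T)) 0 0); last first.
  by rewrite H2 mulmx1 /gip /bil !mulmxA.
have -> : u *m (Gr *m F^T *m eta *m F) *m (Gr *m v^T) =
   (u *m Gr *m F^T *m eta) *m (F *m (Gr *m v^T)) by rewrite !mulmxA.
rewrite [RHS]mxE; apply: eq_bigr => a _.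
rewrite /eta mul_mx_diag mxE.
have e w : gip g i x w (frame j a i x) = (w *m Gr *m F^T) 0 a.
  rewrite /gip /bil !mxE; apply: eq_bigr => m _; rewrite !mxE; congr (_ * _).
have -> : (F *m (Gr *m v^T)) a 0 = gip g i x v (frame j a i x).
  rewrite /gip bilC ?gram_sym// /bil -mulmxA !mxE; apply: eq_bigr => m _.
  by rewrite !mxE.
by rewrite e !mxE; ring.
Qed.

Lemma lift_vectorial (V : local_field A) (psi : local_spinor S) (j : sidx S)
    i x u : sdom j x -> dom i x ->
  spin_connection (vectorial_torsion g V) psi j i x u =
  spin_connection (levi_civita g) psi j i x u +
   (2^-1)%:C *: (wedge_clifford j i x u (V i x) *m psi j x).
Proof.
move=> jx ix; have pars := frame_parseval _ _ jx ix.
rewrite /spin_connection -addrA; congr (_ + _).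
rewrite scalemxAl -mulmxDl; congr (_ *m _).
pose uu a := gip g i x u (frame j a i x).
pose vv a := gip g i x (V i x) (frame j a i x).
have E a b :
    gip g i x (vectorial_torsion g V i (frame j a i) x u) (frame j b i x) =
    gip g i x (levi_civita g i (frame j a i) x u) (frame j b i x)
    + (uu a * vv b - vv a * uu b).
  by rewrite /vectorial_torsion /gip bilBl bilDl !bilZl -/(gip _ _ _ _ _) addrA.
under eq_bigr do under eq_bigr do rewrite E mulrDr rmorphD scalerDl.
under eq_bigr do rewrite big_split /=.
rewrite big_split /=; congr (_ + _).
have cl2 (a b : 'I_n -> R) :
    clif G (\row_k (eps p k * a k)) *m clif G (\row_k (eps p k * b k)) =
   \sum_k \sum_l (eps p k * eps p l * a k * b l)%:C *: (gam G k *m gam G l).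
  rewrite /clif mulmx_suml; apply: eq_bigr => k _.
  rewrite mulmx_sumr; apply: eq_bigr => l _.
  rewrite -scalemxAl -scalemxAr scalerA !mxE -(rmorphM rc).
  by congr (_%:C *: _); ring.
have anti : clifford j i x u *m clifford j i x (V i x) +
    clifford j i x (V i x) *m clifford j i x u =
    (- (2 * gip g i x u (V i x))%:C)%:M.
  rewrite /clifford (cl2 uu vv) (cl2 vv uu).
  rewrite [X in _ + X]exchange_big /= -big_split /=.
  rewrite -pars -[RHS]scalemx1 -(rmorphN rc).
  under eq_bigr => k _.
    rewrite -big_split /=.
    under eq_bigr => l _.
      rewrite (_ : eps p l * eps p k * vv l * uu k =
                   eps p k * eps p l * uu k * vv l); last by ring.
      rewrite -scalerDr gamP.
      rewrite -scalemx1 scalerA -(rmorphN rc).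
      rewrite -(rmorphM rc).
      over.
    rewrite -scaler_suml.
    over.
  rewrite -scaler_suml; under eq_bigr do rewrite -(rmorph_sum rc).
  rewrite -(rmorph_sum rc); congr ((_)%:C *: _).
  rewrite mulr_sumr -sumrN; apply: eq_bigr => k _.
  rewrite (bigD1 k) //= big1 ?addr0 => [|l lk]; last first.
    by rewrite eq_sym (negbTE lk) mulr0 oppr0 mulr0.
  rewrite eqxx -/(uu k) -/(vv k) mulr1.
  have := epsK p k; set e := eps p k; move=> e2.
  transitivity (- (2 * (e * e) * (e * uu k * vv k))); first by ring.
  by rewrite e2; ring.
have [h hh] : exists h : R[i], h = (2^-1)%:C by eexists.
have dbl : h + h = 1.
  by rewrite hh -(rmorphD rc) -(rmorph1 rc); congr (_%:C); field.
have hq : (4^-1 : R)%:C = h * h by rewrite hh -(rmorphM rc); congr (_%:C); field.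
have -> : \sum_a \sum_b
      (4^-1 * eps p a * eps p b * (uu a * vv b - vv a * uu b))%:C *:
      (gam G a *m gam G b) = (h * h) *:
    (clifford j i x u *m clifford j i x (V i x) -
     clifford j i x (V i x) *m clifford j i x u).
  rewrite /clifford (cl2 uu vv) (cl2 vv uu) -sumrB scaler_sumr.
  apply: eq_bigr => a _; rewrite -sumrB scaler_sumr; apply: eq_bigr => b _.
  rewrite -scalerBl scalerA -hq -(rmorphB rc) -(rmorphM rc).
  by congr (_%:C *: _); ring.
rewrite /wedge_clifford -hh.
pose X := clifford j i x u *m clifford j i x (V i x).
pose Y := clifford j i x (V i x) *m clifford j i x u.
have -> : (gip g i x u (V i x))%:C%:M = - h *: (X + Y).
  rewrite /X /Y anti -[LHS]scalemx1 -[in RHS]scalemx1 scalerA; congr (_ *: _).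
  rewrite mulrNN hh -(rmorphM rc); congr (_%:C); by field.
rewrite -/X -/Y.
have hE : h = h * h + h * h by rewrite -mulrDr dbl mulr1.
move: (X) (Y) => {}X {}Y.
rewrite [RHS]scalerDr scalerA mulrN scaleNr {3}hE.
move: (h * h) => q; rewrite scalerDl scalerBr scalerDr opprD addrACA.
by rewrite subrr add0r.
Qed.

Lemma dirac_vectorial (V : local_field A) (psi : local_spinor S) (j : sidx S)
    x : sdom j x ->
  dirac_operator S (vectorial_torsion g V) psi j x =
  dirac_operator S (levi_civita g) psi j x -
  ((n%:R - 1) / 2)%:C *:
    (clifford j (chart_at A x) x (V (chart_at A x) x) *m psi j x).
Proof.
move=> jx; rewrite /dirac_operator; set i := chart_at A x.
have ix : dom i x by apply: chart_atP.
under eq_bigr do rewrite lift_vectorial // mulmxDr scalerDr.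
rewrite big_split /=; congr (_ + _).
pose v := clifford j i x (V i x).
pose vv a := gip g i x (V i x) (frame j a i x).
have clf a : clifford j i x (frame j a i x) = gam G a.
  rewrite /clifford /clif (bigD1 a) //= big1 ?addr0 => [|b ba].
    by rewrite mxE (frame_orthonormal jx ix) eqxx mulr1 epsK scale1r.
  by rewrite mxE (frame_orthonormal jx ix) eq_sym (negbTE ba) !mulr0 scale0r.
have gg a : gam G a *m gam G a = (- (eps p a)%:C)%:M.
  have := gamP G a a; rewrite eqxx mulr1 => e.
  apply: (@scalerI _ _ (2%:R)); first by rewrite pnatr_eq0.
  rewrite scaler_nat mulr2n e -[LHS]scalemx1 -[in RHS]scalemx1 scalerA.
  by rewrite mulrN (rmorphM rc) (rmorph_nat rc).
under eq_bigr => a _.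
  rewrite -scalemxAr mulmxA scalerA mulrC -scalerA scalemxAl.
  rewrite /wedge_clifford clf mulmxDr mulmxA gg.
  over.
rewrite -scaler_sumr -mulmx_suml -scaleNr scalemxAl [in RHS]scalemxAl.
congr (_ *m _).
under eq_bigr => a _.
  rewrite -/v mul_scalar_mx mul_mx_scalar scalerDr !scalerA.
  rewrite mulrN -!(rmorphM rc) epsK.
  rewrite (_ : gip g i x (frame j a i x) (V i x) = vv a); last first.
    by rewrite /vv /gip bilC ?gram_sym.
  over.
rewrite big_split /=.
have -> : \sum_a (eps p a * vv a)%:C *: gam G a = v.
  by rewrite /v /clifford /clif; apply: eq_bigr => a _; rewrite mxE.
rewrite sumr_const card_ord -[X in _ *: (X + _)]scaler_nat.
rewrite [in LHS]scalerA -[X in _ + X]scale1r -scalerDl scalerA; congr (_ *: _).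
rewrite -(rmorph_nat rc) -(rmorph1 rc) -(rmorphN rc) -!(rmorphM rc).
rewrite -(rmorphD rc) -(rmorphM rc) -(rmorphN rc).
by congr (_%:C); field.
Qed.
End VectorialDirac.

(* Main.v *)
(** If V = grad f and c = (n-1)/2, the Leibniz rule gives
    D^g (e^(cf) psi) = e^(cf) (D^g psi + c V . psi), so that
    D (e^(cf) psi) = e^(cf) D^g psi : multiplication by e^(cf), a bijection of
    the smooth spinor fields, conjugates D to D^g. *)
Require Import Defs.
From mathcomp Require Import all_boot all_order all_algebra.
From mathcomp Require Import all_classical all_reals all_analysis.
From mathcomp Require Import complex ring.

Set Implicit Arguments.
Unset Strict Implicit.
Unset Printing Implicit Defensive.

Import Order.TTheory GRing.Theory Num.Theory.
Import numFieldNormedType.Exports.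

Local Open Scope classical_set_scope.
Local Open Scope ring_scope.
Local Open Scope complex_scope.

(** * Stability of class C^k on an open set under products and exponentials *)

Section ClassC.
Context {R : realType} {E : normedModType R}.

(** The two difference quotients coincide once the line through [x] is evaluated at 0. This reduces
    directional derivatives to one real variable, where a chain rule is at hand. *)
Lemma is_derive_line (F : normedModType R) (f : E -> F) (x v : E) (l : F) :
  is_derive x v f l <-> is_derive (0 : R) 1 (fun h : R => f (h *: v + x)) l.
Proof.
have e : 'D_v f x = 'D_1 (fun h : R => f (h *: v + x)) 0.
  rewrite /derive; set q1 := fun h => h^-1 *: _; set q2 := fun h => h^-1 *: _.
  suff -> : q1 = q2 by [].
  apply/funext => h; rewrite /q1 /q2 /=.
  by rewrite addr0 scale0r add0r [_%:A]mulr1.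
split=> -[df fl]; apply: DeriveDef; rewrite -?fl ?e//.
  exact/(derivable1P f x v).1.
exact/(derivable1P f x v).2.
Qed.

Lemma is_derive_comp_real (f : E -> R) (h : R -> R) (x v : E) (a b : R) :
  is_derive (f x) 1 h a -> is_derive x v f b ->
  is_derive x v (h \o f) (a * b).
Proof.
move=> ha /is_derive_line fb; apply/is_derive_line.
apply: (@is_derive1_comp R h (fun t : R => f (t *: v + x))).
by rewrite scale0r add0r.
Qed.

Lemma class_CS (F : normedModType R) k (O O' : set E) (f : E -> F) :
  O `<=` O' -> class_C k O' f -> class_C k O f.
Proof.
move=> sub; elim: k f => [|k IH] f [cf df].
  by split=> // x /sub /cf.
split=> [x /sub /cf//|v]; have [dfv Cfv] := df v.
by split=> [x /sub /dfv//|]; exact: IH.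
Qed.

Variables (O : set E) (openO : open O).

Let near_O x : O x -> \forall y \near x, O y.
Proof. by move=> Ox; exact: open_nbhs_nbhs. Qed.

Let near_eqO (F : normedModType R) (f g : E -> F) x :
  (forall y, O y -> f y = g y) -> O x -> {near x, f =1 g}.
Proof. by move=> fg /near_O; apply: filterS => y /fg. Qed.

(** Since [O] is open, equality on [O] holds near each of its points, so directional derivatives
    agree there too. This lets differentiation formulas valid only on [O] be substituted in the
    inductions below. *)
Lemma eq_class_C (F : normedModType R) k (f g : E -> F) :
  (forall x, O x -> f x = g x) -> class_C k O f -> class_C k O g.
Proof.
elim: k f g => [|k IH] f g fg [cf df]; (split; first by
  move=> x Ox; rewrite /prop_for /continuous_at -(fg _ Ox);
  apply: cvg_trans (cf x Ox); exact/near_eq_cvg/near_eqO) => //.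
move=> v; have [dfv Cfv] := df v; split=> [x Ox|].
  by apply: near_eq_derivable (dfv x Ox); exact: near_eqO.
by apply: IH Cfv => x Ox; apply: near_eq_derive; exact: near_eqO.
Qed.

Lemma class_C_continuous (F : normedModType R) k (f : E -> F) :
  class_C k O f -> forall x, O x -> {for x, continuous f}.
Proof. by case: k => [|k] []. Qed.

Lemma class_C_pred (F : normedModType R) k (f : E -> F) :
  class_C k.+1 O f -> class_C k O f.
Proof.
elim: k f => [|k IH] f [cf df]; split=> // v.
by have [dfv Cfv] := df v; split=> //; exact: IH.
Qed.

Lemma class_C_add (F : normedModType R) k (f g : E -> F) :
  class_C k O f -> class_C k O g -> class_C k O (f + g).
Proof.
elim: k f g => [|k IH] f g Cf Cg;
  (split; first by move=> x Ox; apply: continuousD;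
    [exact: class_C_continuous Cf x Ox
    |exact: class_C_continuous Cg x Ox]) => //.
move=> v; have [df Cdf] := Cf.2 v; have [dg Cdg] := Cg.2 v.
split=> [x Ox|]; first by apply: derivableD; [exact: df|exact: dg].
apply: eq_class_C (IH _ _ Cdf Cdg) => x Ox /=.
by rewrite deriveD; [|exact: df|exact: dg].
Qed.

Lemma class_C_scale (F : normedModType R) k (c : R) (f : E -> F) :
  class_C k O f -> class_C k O (c \*: f).
Proof.
elim: k f => [|k IH] f Cf;
  (split; first by move=> x Ox; apply: continuousZr;
    exact: class_C_continuous Cf x Ox) => //.
move=> v; have [df Cdf] := Cf.2 v.
split=> [x Ox|]; first by apply: derivableZ; exact: df.
apply: eq_class_C (IH _ Cdf) => x Ox /=.
by rewrite deriveZ; [|exact: df].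
Qed.

(** Induction through the Leibniz rule: each product in [f * 'D_v g + g * 'D_v f] pairs a derivative
    of class C^k with an undifferentiated factor, brought down to order [k] by [class_C_pred]. *)
Lemma class_C_mul k (f g : E -> R) :
  class_C k O f -> class_C k O g -> class_C k O (f * g).
Proof.
elim: k f g => [|k IH] f g Cf Cg;
  (split; first by move=> x Ox; apply: continuousM;
    [exact: class_C_continuous Cf x Ox
    |exact: class_C_continuous Cg x Ox]) => //.
move=> v; have [df Cdf] := Cf.2 v; have [dg Cdg] := Cg.2 v.
split=> [x Ox|]; first by apply: derivableM; [exact: df|exact: dg].
have := class_C_add (IH _ _ (class_C_pred Cf) Cdg)
                    (IH _ _ (class_C_pred Cg) Cdf).
apply: eq_class_C => x Ox /=.
by rewrite deriveM; [|exact: df|exact: dg].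
Qed.

(** The derivative [expR (f x) * 'D_v f x] contains the function itself, at one order less, so the
    induction closes with [class_C_mul]. *)
Lemma class_C_expR k (f : E -> R) :
  class_C k O f -> class_C k O (expR \o f).
Proof.
elim: k f => [|k IH] f Cf;
  (split; first by move=> x Ox; apply: continuous_comp;
    [exact: class_C_continuous Cf x Ox|exact: continuous_expR]) => //.
move=> v; have [df Cdf] := Cf.2 v.
have d x : O x -> is_derive x v (expR \o f) (expR (f x) * 'D_v f x).
  by move=> Ox; apply: is_derive_comp_real; exact/derivableP/df.
split=> [x /d[]//|].
have := class_C_mul (IH _ (class_C_pred Cf)) Cdf.
by apply: eq_class_C => x /d[_ ->].
Qed.

End ClassC.

(** * Smooth functions on the manifold and their derivatives in charts *)

Section Manifold.
Context {R : realType} {n : nat} {M : topologicalType}.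
Variable A : smooth_manifold R n M.

(** Near a point of the image of the chart, [param i] is a continuous inverse of [coord i]: nearby
    points stay in the open image of [dom i], and [param i] sends them into [W]. *)
Lemma open_coord_image (i : chart A) (W : set M) :
  open W -> open (Defs.coord i @` (dom i `&` W)).
Proof.
move=> oW; rewrite openE => _ [x [ix Wx] <-].
have oi : \forall y \near Defs.coord i x, (Defs.coord i @` dom i) y.
  by apply: open_nbhs_nbhs; split; [exact: image_open|exists x].
have oW' : \forall y \near Defs.coord i x, W (param i y).
  apply: (param_continuous ix); rewrite /= coordK//.
  exact: open_nbhs_nbhs.
rewrite /interior; near=> y.
have [z iz zy] : (Defs.coord i @` dom i) y by near: y.
exists z => //; split=> //.
have : W (param i y) by near: y.
by rewrite -zy coordK.
Unshelve. all: by end_near. Qed.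

Lemma smooth_derivable (F : normedModType R) (W : set M) (h : M -> F)
    (i : chart A) x :
  smooth A W h -> W x -> dom i x ->
  forall u, derivable (h \o param i) (Defs.coord i x) u.
Proof.
by move=> /(_ i 1%N)[_ Dh] Wx ix u; have [dh _] := Dh u; apply: dh; exists x.
Qed.

Lemma smoothS (F : normedModType R) (W : set M) (h : M -> F) :
  smooth A setT h -> smooth A W h.
Proof.
move=> sh i k; apply: class_CS (sh i k).
by move=> _ [x [ix _] <-]; exists x.
Qed.

Lemma smooth_mul (W : set M) (f h : M -> R) :
  open W -> smooth A W f -> smooth A W h -> smooth A W (f * h).
Proof.
move=> oW sf sh i k.
have oi := open_coord_image (i := i) oW.
exact: (class_C_mul oi (sf i k) (sh i k)).
Qed.

Lemma smooth_expR_scale (W : set M) (c : R) (f : M -> R) :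
  open W -> smooth A W f -> smooth A W (fun x => expR (c * f x)).
Proof.
move=> oW sf i k; have oi := open_coord_image (i := i) oW.
exact: (class_C_expR oi (class_C_scale oi c (sf i k))).
Qed.

Lemma ddirM (W : set M) (f h : M -> R) (i : chart A) x u :
  smooth A W f -> smooth A W h -> W x -> dom i x ->
  ddir i (f * h) x u = ddir i f x u * h x + f x * ddir i h x u.
Proof.
move=> sf sh Wx ix; rewrite /ddir.
have := deriveM (smooth_derivable sf Wx ix (u := u))
                (smooth_derivable sh Wx ix (u := u)).
by rewrite /= coordK// => ->; rewrite addrC; congr (_ + _); exact: mulrC.
Qed.

Lemma ddir_expR_scale (W : set M) (c : R) (f : M -> R) (i : chart A) x u :
  smooth A W f -> W x -> dom i x ->
  ddir i (fun y => expR (c * f y)) x u = expR (c * f x) * (c * ddir i f x u).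
Proof.
move=> sf Wx ix; rewrite /ddir.
have /derivableP df := smooth_derivable sf Wx ix (u := u).
have [_] := is_derive_comp_real (is_derive_expR _) (is_deriveZ c df).
by rewrite /= coordK.
Qed.

End Manifold.

(** * Effect of a rescaling of spinors on the Dirac operators *)

Section Intertwining.
Context {R : realType} {n p : nat} {M : topologicalType}.
Context {A : smooth_manifold R n M} {g : semi_riemannian_metric p A}.
Context {G : spinor_module R n p} (S : spin_structure g G).
Local Notation rc := (real_complex R).

Definition scale_spinor (h : M -> R) (psi : local_spinor S) : local_spinor S :=
  fun j x => (h x)%:C *: psi j x.

Lemma Re_realM (c : R) (z : R[i]) : complex.Re (c%:C * z) = c * complex.Re z.
Proof. by case: z => a b /=; rewrite mul0r subr0. Qed.

Lemma Im_realM (c : R) (z : R[i]) : complex.Im (c%:C * z) = c * complex.Im z.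
Proof. by case: z => a b /=; rewrite mul0r addr0. Qed.

(** The factor is real, so it acts separately on real and imaginary parts; being a scalar common to
    all frames, it commutes with the spin lifts. *)
Lemma scale_spinor_field (h : M -> R) psi :
  smooth A setT h -> spinor_field psi -> spinor_field (scale_spinor h psi).
Proof.
move=> sh [spsi tr]; split=> [j k l|j k x jx kx].
  have [sRe sIm] := spsi j k l; have oj := sdom_open (s := S) j.
  split.
    have -> : (fun x => complex.Re (scale_spinor h psi j x k l)) =
              h * (fun x => complex.Re (psi j x k l)).
      by apply/funext => x; rewrite mxE Re_realM.
    exact: (smooth_mul oj (smoothS (sdom j) sh) sRe).
  have -> : (fun x => complex.Im (scale_spinor h psi j x k l)) =
            h * (fun x => complex.Im (psi j x k l)).
    by apply/funext => x; rewrite mxE Im_realM.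
  exact: (smooth_mul oj (smoothS (sdom j) sh) sIm).
by rewrite /scale_spinor (tr _ _ _ jx kx) scalemxAr.
Qed.

Lemma dspinor_scale (h : M -> R) psi j i x u :
  smooth A setT h -> spinor_field psi -> sdom j x -> dom i x ->
  dspinor (scale_spinor h psi) j i x u =
  (ddir i h x u)%:C *: psi j x + (h x)%:C *: dspinor psi j i x u.
Proof.
move=> sh [spsi _] jx ix; apply/matrixP => k l; rewrite ord1 !mxE.
have [sRe sIm] := spsi j k 0.
have -> : (fun y => complex.Re (scale_spinor h psi j y k 0)) =
          h * (fun y => complex.Re (psi j y k 0)).
  by apply/funext => y; rewrite mxE Re_realM.
have -> : (fun y => complex.Im (scale_spinor h psi j y k 0)) =
          h * (fun y => complex.Im (psi j y k 0)).
  by apply/funext => y; rewrite mxE Im_realM.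
rewrite (ddirM u (smoothS (sdom j) sh) sRe)//.
rewrite (ddirM u (smoothS (sdom j) sh) sIm)//.
case: (psi j x k 0) => a b; apply/eqP; rewrite eq_complex /=.
by rewrite !mul0r !subr0 !addr0 !eqxx.
Qed.

(** Leibniz rule for an arbitrary [nabla]: only the derivative part of the spin connection sees [h].
    The [clif] term is Clifford multiplication by grad h, written in frame components. *)
Lemma dirac_scale nabla (h : M -> R) psi j x : let i := chart_at A x in
  smooth A setT h -> spinor_field psi -> sdom j x ->
  dirac_operator S nabla (scale_spinor h psi) j x =
  (h x)%:C *: dirac_operator S nabla psi j x +
  clif G (\row_a (eps p a * ddir i h x (frame j a i x))) *m psi j x.
Proof.
move=> i sh spsi jx; have ix : dom i x by exact: chart_atP.
rewrite /dirac_operator -/i /clif mulmx_suml scaler_sumr -big_split /=.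
apply: eq_bigr => a _.
rewrite /spin_connection dspinor_scale// /scale_spinor -scalemxAr.
(* Collects the derivative of [psi] and the connection term into [h] times the spin connection of
   [psi], leaving the derivative of [h] alone. *)
rewrite -addrA -scalerDr mulmxDr [LHS]scalerDr [LHS]addrC; congr (_ + _).
  by rewrite -scalemxAr scalerA scalerA mulrC.
by rewrite -scalemxAr scalerA -scalemxAl mxE -(rmorphM rc).
Qed.

Variables (V : local_field A) (f : M -> R).
Hypotheses (sf : smooth A setT f) (gradf : is_gradient g V f).

(** The coefficient of [V] in [dirac_vectorial]: with it, grad h = c h V exactly compensates the
    torsion term. *)
Let c : R := (n%:R - 1) / 2.
Let h x := expR (c * f x).

Let smooth_h : smooth A setT h.
Proof. exact: smooth_expR_scale openT sf. Qed.

Lemma dirac_vectorial_exp psi j x : spinor_field psi -> sdom j x ->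
  dirac_operator S (vectorial_torsion g V) (scale_spinor h psi) j x =
  scale_spinor h (dirac_operator S (levi_civita g) psi) j x.
Proof.
move=> spsi jx; rewrite dirac_vectorial// dirac_scale//.
set i := chart_at A x; have ix : dom i x by exact: chart_atP.
(* Both sides contain [h] times D^g psi; it remains to see that the gradient term and the torsion
   term cancel. *)
rewrite /scale_spinor -[RHS]addr0 -addrA; congr (_ + _).
apply/eqP; rewrite subr_eq0; apply/eqP.
rewrite -scalemxAr scalerA scalemxAl; congr (_ *m _).
rewrite /clifford /clif scaler_sumr; apply: eq_bigr => a _.
(* The frame components of [V] become derivatives of [f], to be matched with those of the
   exponential. *)
rewrite !mxE scalerA (gradf ix) (ddir_expR_scale _ _ sf)//.
by rewrite -!(rmorphM rc); congr (_%:C *: _); rewrite /h -/c; ring.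
Qed.

End Intertwining.

(** * Spectra of two operators intertwined by an invertible function *)

Section Conjugation.
Context {R : realType} {n p : nat} {M : topologicalType}.
Context {A : smooth_manifold R n M} {g : semi_riemannian_metric p A}.
Context {G : spinor_module R n p} {S : spin_structure g G}.

Lemma scale_spinorK (h k : M -> R) : (forall x, h x * k x = 1) ->
  cancel (@scale_spinor _ _ _ _ _ _ _ S k) (scale_spinor h).
Proof.
move=> hk psi; apply/funext => j; apply/funext => x.
by rewrite /scale_spinor scalerA -(rmorphM (real_complex R)) hk scale1r.
Qed.

Lemma scale_spinor_eq (h : M -> R) (psi phi : local_spinor S) :
  spinor_eq psi phi -> spinor_eq (scale_spinor h psi) (scale_spinor h phi).
Proof. by move=> e j x jx; rewrite /scale_spinor e. Qed.

Variables (h k : M -> R) (D D' : local_spinor S -> local_spinor S).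
Hypotheses (hk : forall x, h x * k x = 1).
Hypotheses (sh : smooth A setT h) (sk : smooth A setT k).
Hypothesis DD' : forall psi, spinor_field psi ->
  spinor_eq (D (scale_spinor h psi)) (scale_spinor h (D' psi)).

Let kh x : k x * h x = 1. Proof. by rewrite mulrC. Qed.

(** The scalar [lam] commutes with [h], so the intertwining relation passes to the shifted
    operators; the converse multiplies by the inverse [k]. *)
Let shift_scale lam psi phi : spinor_field psi ->
  spinor_eq (fun j x => D' psi j x - lam *: psi j x) phi <->
  spinor_eq (fun j x => D (scale_spinor h psi) j x
                        - lam *: scale_spinor h psi j x) (scale_spinor h phi).
Proof.
move=> spsi; split=> e.
  move=> j x jx; rewrite DD'// /scale_spinor -e// scalerBr !scalerA.
  by rewrite [lam * _]mulrC.
move=> j x jx; have := e j x jx; rewrite DD'// /scale_spinor.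
rewrite scalerA mulrC -scalerA -scalerBr.
move=> /(congr1 (fun v => (k x)%:C *: v)).
by rewrite !scalerA -(rmorphM (real_complex R)) kh !scale1r.
Qed.

Lemma eigenvalues_conj : eigenvalues D' `<=` eigenvalues D.
Proof.
move=> lam [psi [spsi psi0 e]]; exists (scale_spinor h psi).
split; first exact: scale_spinor_field.
  (* Multiplying by [k] recovers [psi], so the rescaled eigenspinor cannot vanish. *)
  move=> e0; apply: psi0 => j x jx.
  have /(_ j x jx) := scale_spinor_eq k e0.
  by rewrite scale_spinorK// /scale_spinor scaler0.
by move=> j x jx; rewrite DD'// /scale_spinor e// !scalerA mulrC.
Qed.

(** By contraposition: if D - lam is bijective, the unique solution of (D' - lam) psi = phi is [k]
    times the solution for D with right-hand side [h] phi. *)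
Lemma spectrum_conj : spectrum D' `<=` spectrum D.
Proof.
move=> lam; apply: contra_not => bij phi sphi.
have [psi [spsi e u]] := bij _ (scale_spinor_field sh sphi).
exists (scale_spinor k psi); have skpsi := scale_spinor_field sk spsi.
split=> // [|psi' spsi' e'].
  by apply/shift_scale => //; rewrite scale_spinorK.
(* Uniqueness: [h] times another solution solves the equation for D, hence equals the solution
   there; multiply back by [k]. *)
have /u : spinor_field (scale_spinor h psi') by exact: scale_spinor_field.
move=> /(_ ((shift_scale _ _ spsi').1 e')) /(scale_spinor_eq k).
by rewrite scale_spinorK.
Qed.

End Conjugation.

Theorem proposition4p1 (R : realType) (n p : nat) (hp : (p <= n)%N)
  (M : topologicalType) (A : smooth_manifold R n M)
  (g : semi_riemannian_metric p A) (G : spinor_module R n p)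
  (S : spin_structure g G) (V : local_field A) (hV : exact_field g V) :
  spectrum (dirac_operator S (vectorial_torsion g V)) =
    spectrum (dirac_operator S (levi_civita g)) /\
  eigenvalues (dirac_operator S (vectorial_torsion g V)) =
    eigenvalues (dirac_operator S (levi_civita g)).
Proof.
have [_ [f sf gradf]] := hV.
pose c : R := (n%:R - 1) / 2.
(* Writing the inverse of [h] as an exponential gives its smoothness by the same lemma. *)
pose h x := expR (c * f x); pose k x := expR (- c * f x).
have hk x : h x * k x = 1 by rewrite /h /k mulNr expRxMexpNx_1.
have kh x : k x * h x = 1 by rewrite mulrC.
have sh : smooth A setT h := smooth_expR_scale c openT sf.
have sk : smooth A setT k := smooth_expR_scale (- c) openT sf.
have DD' psi : spinor_field psi -> spinor_eq
    (dirac_operator S (vectorial_torsion g V) (scale_spinor h psi))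
    (scale_spinor h (dirac_operator S (levi_civita g) psi)).
  by move=> spsi j x jx; exact: dirac_vectorial_exp.
have D'D psi : spinor_field psi -> spinor_eq
    (dirac_operator S (levi_civita g) (scale_spinor k psi))
    (scale_spinor k (dirac_operator S (vectorial_torsion g V) psi)).
  (* The reverse intertwining comes from the direct one applied to [k] psi, then multiplied by
     [k]. *)
  move=> spsi; have /DD' := scale_spinor_field sk spsi.
  rewrite (scale_spinorK hk) => /(scale_spinor_eq k).
  rewrite (scale_spinorK kh) => e j x jx; exact/esym/e.
(* Each intertwining relation yields one inclusion, for the spectrum and for the eigenvalues
   alike. *)
by split; apply/seteqP; split;
  [exact: spectrum_conj D'D|exact: spectrum_conj DD'
  |exact: eigenvalues_conj D'D|exact: eigenvalues_conj DD'].
Qed.
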